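(* Let $X$ be a scheme over a field $k$, and let $G$ be a finite group acting on $X$ so that the quotient $Y=X/G$ exists as a scheme. Suppose additionally that $k=H^0(X,\mathcal{O}_X)$ and that there is a $k$-rational point $x\in X$ fixed by $G$. Then the canonical map $H^1(Y,\mathcal{O}_Y)\to H^1(X,\mathcal{O}_X)$ is injective.
   Context: The action of $G$ is by automorphisms of the $k$-scheme $X$. With quotient map $\nu:X\to Y=X/G$, the underlying space of $Y$ is the topological quotient and $\mathcal{O}_Y=(\nu_*\mathcal{O}_X)^G$; the canonical map is pullback along $\nu$. *)

(* Defs.v *)
From HB Require Import structures.
From mathcomp Require Import all_boot all_order all_algebra fingroup.
From mathcomp Require Import generic_quotient ring_quotient.
From mathcomp Require Import all_classical.
From mathcomp Require Import topology.

Set Implicit Arguments.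
Unset Strict Implicit.
Unset Printing Implicit Defensive.

Import GRing.Theory.

Local Open Scope classical_set_scope.
Local Open Scope ring_scope.

Record opens (X : topologicalType) :=
  Opens { oset :> set X; openP : open oset }.

Definition fullopen (X : topologicalType) : opens X := Opens (@openT X).

Definition preim (X Y : topologicalType) (f : X -> Y) (cf : continuous f)
    (V : opens Y) : opens X :=
  Opens (iffLR (continuousP f) cf _ (openP V)).

Section SheafConditions.
Variables (X : topologicalType) (F : opens X -> Type).
Variable res : forall U V : opens X, V `<=` U -> F U -> F V.

Definition presheaf_cond : Prop :=
  (forall (U : opens X) (h : U `<=` U) s, res h s = s) /\
  (forall (U V W : opens X) (hVU : V `<=` U) (hWV : W `<=` V)
     (hWU : W `<=` U) s, res hWV (res hVU s) = res hWU s).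

(* The family V is an open cover of U; the case of an empty family forces the
   sections over the empty set to be a singleton. *)
Definition sheaf_cond : Prop :=
  forall (I : Type) (U : opens X) (V : I -> opens X)
    (hV : forall i, V i `<=` U), (U : set X) = \bigcup_i V i ->
    (forall s t : F U, (forall i, res (hV i) s = res (hV i) t) -> s = t) /\
    (forall s : forall i, F (V i),
       (forall i j (W : opens X) (hi : W `<=` V i) (hj : W `<=` V j),
          res hi (s i) = res hj (s j)) ->
       exists t : F U, forall i, res (hV i) t = s i).

End SheafConditions.

Record absheaf (X : topologicalType) := AbSheaf {
  sec :> opens X -> zmodType;
  res : forall U V : opens X, V `<=` U -> {additive sec U -> sec V};
  res_presheaf : presheaf_cond res;
  res_sheaf : sheaf_cond res }.
Arguments res {X a U V}.
Arguments res_presheaf {X} a.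
Arguments res_sheaf {X} a.

(* The sections over the empty set form the zero ring, so the rings cannot be
   required to be nontrivial. *)
Record ringsheaf (X : topologicalType) := RingSheaf {
  rsec :> opens X -> comPzRingType;
  rres : forall U V : opens X, V `<=` U -> {rmorphism rsec U -> rsec V};
  rres_presheaf : presheaf_cond rres;
  rres_sheaf : sheaf_cond rres }.
Arguments rres {X r U V}.
Arguments rres_presheaf {X} r.
Arguments rres_sheaf {X} r.

Definition ab_of_ring (X : topologicalType) (O : ringsheaf X) : absheaf X :=
  @AbSheaf X (fun U => O U : zmodType)
    (fun U V h => @rres X O U V h : {additive O U -> O V})
    (rres_presheaf O) (rres_sheaf O).

Record sheafhom (X : topologicalType) (F G : absheaf X) := SheafHom {
  shom :> forall U : opens X, {additive F U -> G U};
  shom_res : forall (U V : opens X) (h : V `<=` U) (s : F U),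
    shom V (res h s) = res h (shom U s) }.

Lemma preim_sub (X Y : topologicalType) (f : X -> Y) (cf : continuous f)
  (U V : opens Y) : V `<=` U -> preim cf V `<=` preim cf U.
Proof. by move=> h x; apply: h. Qed.

Arguments preim_sub {X Y f} cf {U V} _.

Section Pushforward.
Variables (X Y : topologicalType) (f : X -> Y) (cf : continuous f).
Variable F : absheaf X.

Let psec (V : opens Y) : zmodType := F (preim cf V).
Let pres (U V : opens Y) (h : V `<=` U) : {additive psec U -> psec V} :=
  res (preim_sub cf h).

Lemma push_presheaf : presheaf_cond pres.
Proof.
have [r1 r2] := res_presheaf F; split=> [U h s|U V W h1 h2 h3 s].
  exact: r1.
exact: r2.
Qed.

Lemma push_sheaf : sheaf_cond pres.
Proof.
move=> I U V hV UV.
have cov : (preim cf U : set X) = \bigcup_i preim cf (V i).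
  by rewrite /= UV preimage_bigcup.
have [sep glue] := res_sheaf F _ _ _ (fun i => preim_sub cf (hV i)) cov.
split=> [s t|s sV]; first exact: sep.
apply: glue => i j W hi hj.
have [_ r2] := res_presheaf F.
pose VV := Opens (openI (openP (V i)) (openP (V j))).
have hiV : VV `<=` V i by move=> y [].
have hjV : VV `<=` V j by move=> y [].
have hW : W `<=` preim cf VV by move=> x Wx; split; [exact: hi|exact: hj].
have := congr1 (res hW) (sV i j VV hiV hjV).
by rewrite /pres !(r2 _ _ _ _ _ hi) !(r2 _ _ _ _ _ hj).
Qed.

Definition pushforward : absheaf Y :=
  @AbSheaf Y psec pres push_presheaf push_sheaf.

End Pushforward.

Section InjectiveResolutions.
Variable X : topologicalType.

Definition mono_sheafhom (F G : absheaf X) (a : sheafhom F G) : Prop :=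
  forall U : opens X, injective (a U).

Definition exact_sheafhom (F G H : absheaf X) (a : sheafhom F G)
    (b : sheafhom G H) : Prop :=
  (forall (U : opens X) (s : F U), b U (a U s) = 0) /\
  (forall (U : opens X) (t : G U), b U t = 0 ->
     forall x, oset U x -> exists (V : opens X) (h : V `<=` U) (s : F V),
       oset V x /\ a V s = res h t).

Definition injective_sheaf (J : absheaf X) : Prop :=
  forall (F G : absheaf X) (a : sheafhom F G) (u : sheafhom F J),
    mono_sheafhom a ->
    exists v : sheafhom G J, forall (U : opens X) (s : F U),
      v U (a U s) = u U s.

Record injres (F : absheaf X) := InjRes {
  term :> nat -> absheaf X;
  diff : forall n, sheafhom (term n) (term n.+1);
  aug : sheafhom F (term 0%N);
  term_injective : forall n, injective_sheaf (term n);
  aug_mono : mono_sheafhom aug;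
  aug_exact : exact_sheafhom aug (diff 0%N);
  diff_exact : forall n, exact_sheafhom (diff n) (diff n.+1) }.

End InjectiveResolutions.

Section Cohomology.
Variables (X : topologicalType) (F : absheaf X) (I : injres F).
Notation Gamma n := (I n (fullopen X)).
Notation d n := (diff I n (fullopen X)).

Definition cocycle n : pred (Gamma n) := [pred s | d n s == 0].
Fact cocycle_closed n : zmod_closed (@cocycle n).
Proof.
split=> [|s t]; rewrite !inE ?raddf0 // => /eqP ds /eqP dt.
by rewrite raddfB ds dt subrr.
Qed.
HB.instance Definition _ n :=
  GRing.isZmodClosed.Build (Gamma n) (@cocycle n) (@cocycle_closed n).

Record Zn n := ZnSub { Zn_val : Gamma n; Zn_valP : Zn_val \in @cocycle n }.
HB.instance Definition _ n := [isSub for @Zn_val n].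
HB.instance Definition _ n := [Choice of Zn n by <:].
HB.instance Definition _ n := [SubChoice_isSubZmodule of Zn n by <:].

(* In degree 0 the incoming differential is 0. *)
Definition is_coboundary n : Gamma n -> Prop :=
  match n with
  | 0 => fun s => s = 0
  | m.+1 => fun s => exists t : Gamma m, d m t = s
  end.
Definition coboundary n : pred (Zn n) :=
  [pred z | `[< is_coboundary (val z) >]].
Fact coboundary_closed n : zmod_closed (@coboundary n).
Proof.
split; first by apply/asboolP; case: n => //= n; exists 0; rewrite raddf0.
move=> s t /asboolP sB /asboolP tB; apply/asboolP; move: s t sB tB.
case: n => [|n] s t; rewrite raddfB.
  by move=> /= -> ->; rewrite subrr.
by move=> [a da] [b db]; exists (a - b); rewrite raddfB da db.
Qed.
HB.instance Definition _ n :=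
  GRing.isZmodClosed.Build (Zn n) (@coboundary n) (@coboundary_closed n).

(* R^n Gamma (F), computed on the injective resolution I of F. *)
Definition H n : Type :=
  @Quotient.quot (Zn n) (GRing.ZmodClosed.clone (Zn n) (@coboundary n) _).
HB.instance Definition _ n := GRing.Zmodule.on (H n).
HB.instance Definition _ n := Quotient.on (H n).

End Cohomology.

Section CohomologyMap.
Variables (X Y : topologicalType) (f : X -> Y) (cf : continuous f).
Variables (FY : absheaf Y) (FX : absheaf X).
Variable theta : sheafhom FY (pushforward cf FX).
Variables (IY : injres FY) (IX : injres FX).

(* A morphism of complexes IY -> f_* IX extending theta. *)
Record lifting := Lifting {
  lift_hom :> forall n, sheafhom (IY n) (pushforward cf (IX n));
  lift_diff : forall n (V : opens Y) (s : IY n V),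
    lift_hom n.+1 V (diff IY n V s) = diff IX n (preim cf V) (lift_hom n V s);
  lift_aug : forall (V : opens Y) (s : FY V),
    lift_hom 0%N V (aug IY V s) = aug IX (preim cf V) (theta V s) }.

Variable phi : lifting.

Lemma fullopen_preim : fullopen X `<=` preim cf (fullopen Y).
Proof. by []. Qed.

(* Restriction along [fullopen_preim] is the identification
   Gamma(Y, f_* J) = Gamma(X, J). *)
Definition glift n (s : IY n (fullopen Y)) : IX n (fullopen X) :=
  res fullopen_preim (phi n (fullopen Y) s).

Lemma gliftB n : {morph @glift n : s t / s - t}.
Proof. by move=> s t; rewrite /glift !raddfB. Qed.

Lemma glift_diff n s :
  glift (diff IY n (fullopen Y) s) = diff IX n (fullopen X) (@glift n s).
Proof. by rewrite /glift lift_diff shom_res. Qed.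

Lemma glift_cocycle n s :
  s \in @cocycle Y FY IY n -> glift s \in @cocycle X FX IX n.
Proof.
by rewrite !inE -glift_diff => /eqP ->; rewrite /glift !raddf0.
Qed.

Definition Zmap n (z : Zn IY n) : Zn IX n :=
  ZnSub (glift_cocycle (Zn_valP z)).

Definition Hmap n (c : H IY n) : H IX n :=
  (\pi_(H IX n) (Zmap (repr c)))%qT.

Lemma Hmap_pi n (z : Zn IY n) :
  Hmap (\pi_(H IY n) z)%qT = (\pi_(H IX n) (Zmap z))%qT.
Proof.
apply/eqP; rewrite -[_ == _]Quotient.idealrBE /Quotient.equiv.
have := eqxx (\pi_(H IY n) z)%qT.
rewrite -{1}[(\pi_(H IY n) z)%qT]reprK -[_ == _]Quotient.idealrBE.
move: (repr _) => z'; rewrite !unfold_in; move: z z'.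
case: n => [|n] z z' /asboolP /= B; apply/asboolP => /=.
  by rewrite -gliftB B /glift !raddf0.
by case: B => t tE; exists (glift t); rewrite -gliftB -tE glift_diff.
Qed.

End CohomologyMap.

(* The germ of s at x is a unit of the stalk O_x: unfolding the direct limit, x
   has a neighbourhood on which s is invertible. *)
Definition germ_unit (X : topologicalType) (O : ringsheaf X) (U : opens X)
    (s : O U) (x : X) : Prop :=
  exists (V : opens X) (h : V `<=` U) (t : O V), oset V x /\ rres h s * t = 1.

(* The stalks are local rings: they are nonzero, and a sum of two nonunits is a
   nonunit.  A germ lies in the maximal ideal iff it is not a unit. *)
Definition local_stalks (X : topologicalType) (O : ringsheaf X) : Prop :=
  forall (x : X) (U : opens X), oset U x ->
    ~ germ_unit (0 : O U) x /\
    (forall s t : O U, germ_unit (s + t) x -> germ_unit s x \/ germ_unit t x).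

(* Spec A is the type [prime_idealr A] of prime ideals, with the Zariski
   topology, whose open sets are the complements of the sets
   V(S) = {p | S is contained in p}. *)
Section Spec.
Variable A : comNzRingType.

Definition Spec := prime_idealr A.

HB.instance Definition _ := gen_eqMixin Spec.
HB.instance Definition _ := gen_choiceMixin Spec.

Definition in_prime (p : Spec) : pred A := p : A -> bool.

Definition zariski_closed (S : set A) : set Spec :=
  [set p | forall f, S f -> f \in in_prime p].
Definition zariski_open : set_system Spec :=
  [set W | exists S : set A, W = ~` zariski_closed S].

Lemma zariski_openP (S : set A) :
  ~` zariski_closed S = [set p | exists2 f, S f & f \notin in_prime p].
Proof.
apply/seteqP; split=> p /=.
  by move=> /existsNP [f /not_implyP [Sf /negP pf]]; exists f.
by move=> [f Sf /negP pf] /(_ f Sf).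
Qed.

Lemma zariski_openT : zariski_open setT.
Proof.
exists setT; rewrite zariski_openP; apply/seteqP; split=> // p _.
by exists 1 => //; have /= -> := idealr1 p.
Qed.
Lemma zariski_openI : setI_closed zariski_open.
Proof.
move=> _ _ [S ->] [T ->].
exists [set h | exists f g, [/\ S f, T g & h = f * g]]; rewrite !zariski_openP.
apply/seteqP; split=> p /=.
  move=> [[f Sf pf] [g Tg pg]]; exists (f * g); first by exists f, g.
  by rewrite prime_idealrM negb_or pf.
move=> [_ [f [g [Sf Tg ->]]]]; rewrite prime_idealrM negb_or => /andP[pf pg].
by split; [exists f|exists g].
Qed.
Lemma zariski_open_bigU (I : Type) (W : I -> set Spec) :
  (forall i, zariski_open (W i)) -> zariski_open (\bigcup_i W i).
Proof.
move=> /choice [S WS]; exists (\bigcup_i S i).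
rewrite zariski_openP; apply/seteqP; split=> p.
  move=> [i _]; rewrite WS zariski_openP => -[f Sf pf].
  by exists f => //; exists i.
move=> [f [i _ Sf] pf]; exists i => //.
by rewrite WS zariski_openP; exists f.
Qed.

HB.instance Definition _ := isOpenTopological.Build Spec
  zariski_openT zariski_openI zariski_open_bigU.

Definition basic_open (f : A) : set Spec := [set p | f \notin in_prime p].

End Spec.

(* phi : A -> B is the localization of A at the powers of f *)
Definition is_localization (A B : comPzRingType) (f : A) (phi : A -> B) : Prop :=
  [/\ exists t, phi f * t = 1,
      forall b, exists n a, phi f ^+ n * b = phi a &
      forall a, phi a = 0 -> exists n, f ^+ n * a = 0].

(* (U, O|_U) is isomorphic to Spec A as a ringed space: h identifies Spec A
   with U, and the structure sheaf of Spec A is the sheaf whose ring of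
   sections over the basic open set D(f) is the localization A_f. *)
Definition affine_open (X : topologicalType) (O : ringsheaf X)
    (U : opens X) : Prop :=
  exists (A : comNzRingType) (h : Spec A -> X) (phi : {rmorphism A -> O U}),
    [/\ injective h, range h = U, continuous h,
        forall W : set (Spec A), open W -> open (h @` W) &
        forall (f : A) (V : opens X) (hV : V `<=` U),
          (V : set X) = h @` basic_open f ->
          is_localization f (fun a => rres hV (phi a))].

Record scheme := Scheme {
  space :> topologicalType;
  strsheaf : ringsheaf space;
  scheme_local : local_stalks strsheaf;
  scheme_affine : forall x : space,
    exists U : opens space, oset U x /\ affine_open strsheaf U }.

Notation O_ X := (ab_of_ring (strsheaf X)).

Record schememor (X Y : scheme) := SchemeMor {
  mfun :> X -> Y;
  mcont : continuous mfun;
  sharp : forall V : opens Y,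
    {rmorphism strsheaf Y V -> strsheaf X (preim mcont V)};
  sharp_res : forall (U V : opens Y) (h : V `<=` U) s,
    sharp V (rres h s) = rres (preim_sub mcont h) (sharp U s);
  sharp_local : forall (V : opens Y) s x, oset V (mfun x) ->
    germ_unit (sharp V s) x -> germ_unit s (mfun x) }.
Arguments mcont {X Y} _.
Arguments sharp {X Y} _ V.
Arguments sharp_res {X Y} _ {U V}.

(* The map f^#: O_Y -> f_* O_X, as a map of sheaves of abelian groups. *)
Definition sharp_hom (X Y : scheme) (f : schememor X Y) :
    sheafhom (O_ Y) (pushforward (mcont f) (O_ X)) :=
  @SheafHom Y (O_ Y) (pushforward (mcont f) (O_ X))
    (fun V => sharp f V : {additive _ -> _}) (@sharp_res X Y f).

(* Equality of morphisms.  For pointwise equal f and g the rings of sections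
   over the preimages of V under f and g are compared by restriction. *)
Definition eq_mor (X Y : scheme) (f g : schememor X Y) : Prop :=
  (f : X -> Y) =1 g /\
  forall (V : opens Y) (s : strsheaf Y V) (U : opens X)
    (hf : U `<=` preim (mcont f) V) (hg : U `<=` preim (mcont g) V),
    rres hf (sharp f V s) = rres hg (sharp g V s).


Section IdComp.
Variables X Y Z : scheme.

Lemma id_cont : continuous (fun x : X => x).
Proof. by move=> x; exact: cvg_id. Qed.
Lemma id_sub (V : opens X) : preim id_cont V `<=` V.
Proof. by []. Qed.

Lemma id_sharp_res (U V : opens X) (h : V `<=` U) (s : strsheaf X U) :
  rres (@id_sub V) (rres h s) = rres (preim_sub id_cont h) (rres (@id_sub U) s).
Proof.
have [_ r2] := rres_presheaf (strsheaf X).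
have hVU : preim id_cont V `<=` U by exact: h.
by rewrite !(r2 _ _ _ _ _ hVU).
Qed.

Lemma germ_unit_res (T : topologicalType) (O : ringsheaf T) (U V : opens T)
  (h : V `<=` U) (s : O U) x : germ_unit (rres h s) x -> germ_unit s x.
Proof.
have [_ r2] := rres_presheaf O.
move=> [W [hWV [t [Wx st]]]]; have hWU := subset_trans hWV h.
by exists W, hWU, t; split=> //; rewrite -(r2 _ _ _ h hWV).
Qed.

Definition id_mor : schememor X X :=
  @SchemeMor X X _ id_cont (fun V => rres (@id_sub V)) id_sharp_res
    (fun V s x _ => @germ_unit_res _ _ _ _ (@id_sub V) s x).

Variables (g : schememor Y Z) (f : schememor X Y).

Lemma comp_cont : continuous (g \o f).
Proof. by move=> x; apply: continuous_comp; apply: mcont. Qed.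
Lemma comp_sub (W : opens Z) :
  preim comp_cont W `<=` preim (mcont f) (preim (mcont g) W).
Proof. by []. Qed.

Definition comp_sharp (W : opens Z) :
    {rmorphism strsheaf Z W -> strsheaf X (preim comp_cont W)} :=
  rres (@comp_sub W) \o (sharp f (preim (mcont g) W) \o sharp g W).

Lemma comp_sharp_res (U V : opens Z) (h : V `<=` U) (s : strsheaf Z U) :
  comp_sharp V (rres h s) = rres (preim_sub comp_cont h) (comp_sharp U s).
Proof.
have [_ r2] := rres_presheaf (strsheaf X).
rewrite /comp_sharp /= !sharp_res.
have hVU : preim comp_cont V `<=` preim (mcont f) (preim (mcont g) U).
  by move=> x; exact: h.
by rewrite !(r2 _ _ _ _ _ hVU).
Qed.

Lemma comp_sharp_local (V : opens Z) (s : strsheaf Z V) x :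
  oset V ((g \o f) x) -> germ_unit (comp_sharp V s) x ->
  germ_unit s ((g \o f) x).
Proof.
move=> Vx /germ_unit_res /= u.
by apply: (sharp_local (s := s)) => //; apply: (sharp_local (V := preim _ V)) u.
Qed.

Definition comp_mor : schememor X Z :=
  @SchemeMor X Z (g \o f) comp_cont comp_sharp comp_sharp_res comp_sharp_local.

End IdComp.

(* The structure morphism X -> Spec k is given by a ring morphism
   k -> Gamma(X, O_X). *)
Record kscheme (k : fieldType) := KScheme {
  kspace :> scheme;
  kstr : {rmorphism k -> strsheaf kspace (fullopen kspace)} }.

Definition kconst (k : fieldType) (X : kscheme k) (U : opens X) (c : k) :
    strsheaf X U :=
  rres (@subsetT _ U : U `<=` fullopen X) (kstr X c).

Definition over_k (k : fieldType) (X X' : kscheme k) (f : schememor X X') :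
    Prop :=
  forall c : k, sharp f (fullopen X') (kstr X' c) =
    kconst (preim (mcont f) (fullopen X')) c.

(* X(k) is identified with the set of points x whose residue field is k.  The
   maximal ideal at x consists of the germs that are not units, so this says
   that every germ at x is congruent to a constant modulo that ideal. *)
Definition rational_point (k : fieldType) (X : kscheme k) (x : X) : Prop :=
  forall (U : opens X) (s : strsheaf X U), oset U x ->
    exists c : k, ~ germ_unit (s - kconst U c) x.

Record kaction (k : fieldType) (G : finGroupType) (X : kscheme k) := KAction {
  act :> G -> schememor X X;
  act1 : eq_mor (act 1%g) (id_mor X);
  actM : forall g h : G, eq_mor (act (g * h)%g) (comp_mor (act g) (act h));
  act_over : forall g : G, over_k (act g) }.

Section Quotient.
Variables (k : fieldType) (G : finGroupType) (X : kscheme k).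
Variables (rho : kaction G X) (Y : scheme) (nu : schememor X Y).

(* g^# maps O_X(W) to O_X(g^-1 W); when W is G-stable g^-1 W = W, and the two
   restrictions below are to this common open set W. *)
Definition invariant_section (W : opens X) (s : strsheaf X W) : Prop :=
  forall (g : G) (U : opens X) (hU : U `<=` W)
    (hgU : U `<=` preim (mcont (rho g)) W),
    rres hgU (sharp (rho g) W s) = rres hU s.

(* nu : X -> Y exhibits Y as the ringed space X/G: the space Y is the
   topological quotient and nu^# identifies O_Y with (nu_* O_X)^G. *)
Record is_quotient : Prop := IsQuotient {
  quot_surj : forall y : Y, exists x : X, nu x = y;
  quot_orbit : forall x x' : X, nu x = nu x' <-> exists g : G, rho g x = x';
  quot_open : forall V : set Y, open (nu @^-1` V) -> open V;
  quot_inj : forall V : opens Y, injective (sharp nu V);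
  quot_inv : forall (V : opens Y) (s : strsheaf X (preim (mcont nu) V)),
    (exists t, sharp nu V t = s) <-> invariant_section s }.

End Quotient.

Arguments Hmap {X Y f cf FY FX theta IY IX} phi n c : rename.

(* Main.v *)
Require Import Defs.
From mathcomp Require Import all_boot all_order all_algebra fingroup.
From mathcomp Require Import generic_quotient ring_quotient all_classical topology.
(* [preim] is to be the preimage of an open set, not of a boolean predicate. *)
Import Defs.

(** The kernel of H^1(Y, O_Y) -> H^1(X, O_X) is controlled by the exact sequence
    0 -> O_Y -> nu_* O_X -> Q -> 0: since H^1(Y, nu_* O_X) embeds in H^1(X, O_X),
    the map is injective as soon as every global section of Q lifts to one of
    nu_* O_X ([Hmap1_inj], true for any injective theta : FY -> f_* FX).

    A global section of Q is a family of local sections s of nu_* O_X that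
    differ on overlaps by sections of O_Y, that is, by G-invariant functions.
    For g in G the functions g s - s therefore agree on overlaps and glue to a
    global function on X, which is a constant a in k.  At the fixed rational
    point x, write s = c + m with c constant and m in the maximal ideal; then
    g s - s = g m - m lies in the maximal ideal ([translateB_fixed_point]),
    because g fixes x.  So a = 0, every s is invariant, hence comes from O_Y, and
    the given section of Q is 0 ([coker_section_quotient]).

    The criterion itself is a diagram chase on injective resolutions.  If z is a
    1-cocycle on Y whose image is d t, then the images on X of local solutions s
    of d s = z differ from t by local sections of f_* FX, which form a global
    section of the cokernel of theta.  Lifting it to e, the conditions d s = z and
    phi s = t + e have a unique local solution, hence a global one
    ([coboundary_descent]). *)

Set Implicit Arguments.
Unset Strict Implicit.
Unset Printing Implicit Defensive.

Import GRing.Theory.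

Local Open Scope classical_set_scope.
Local Open Scope ring_scope.

(** * Local construction of sections *)

Section Gluing.
Variable X : topologicalType.

Lemma sub_fullopen (V : opens X) : V `<=` fullopen X.
Proof. by []. Qed.

Lemma res_comp (F : absheaf X) (U V W : opens X) (hVU : V `<=` U)
    (hWV : W `<=` V) (hWU : W `<=` U) (s : F U) :
  res hWV (res hVU s) = res hWU s.
Proof. by have [_ ->] := res_presheaf F. Qed.

Lemma eq_locally (F : absheaf X) (U : opens X) (s t : F U) :
  (forall x, oset U x -> exists (V : opens X) (h : V `<=` U),
     oset V x /\ res h s = res h t) -> s = t.
Proof.
move=> loc.
pose I := {V : opens X | exists h : V `<=` U, res h s = res h t}.
have hV (i : I) : sval i `<=` U by case: i => V [].
have cov : (U : set X) = \bigcup_(i : I) oset (sval i).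
  apply/seteqP; split=> [x Ux|x [i _]]; last exact: hV.
  have [V [h [Vx eqV]]] := loc x Ux.
  by exists (exist _ V (ex_intro _ h eqV)).
have [sep _] := res_sheaf F I U (fun i => sval i) hV cov.
apply: sep => -[V [h eqV]].
by move: (hV _) => /= h'; rewrite (Prop_irrelevance h' h).
Qed.

(** Unique local existence gives global existence.  Indexing the cover by all
    pairs (V, s) that satisfy P makes any choice of local sections
    unnecessary. *)
Lemma glue_locally (F : absheaf X) (U : opens X)
    (P : forall V : opens X, F V -> Prop) :
  (forall (V V' W : opens X) (h : W `<=` V) (h' : W `<=` V')
     (s : F V) (s' : F V'), P V s -> P V' s' -> res h s = res h' s') ->
  (forall x, oset U x -> exists (V : opens X) (s : F V),
     [/\ V `<=` U, oset V x & P V s]) ->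
  exists t : F U, forall (V : opens X) (h : V `<=` U) (s : F V),
    P V s -> res h t = s.
Proof.
move=> agree loc.
pose I := {V : opens X & {s : F V | V `<=` U /\ P V s}}.
pose VI (i : I) := projT1 i.
pose sI (i : I) : F (VI i) := sval (projT2 i).
have hV i : VI i `<=` U by case: i => V [s []].
have Ps i : P (VI i) (sI i) by case: i => V [s []].
have cov : (U : set X) = \bigcup_(i : I) oset (VI i).
  apply/seteqP; split=> [x Ux|x [i _]]; last exact: hV.
  have [V [s [VU Vx PVs]]] := loc x Ux.
  by exists (existT _ V (exist _ s (conj VU PVs))).
have [_ glue] := res_sheaf F I U VI hV cov.
have [|t tE] := glue sI; first by move=> i j W hi hj; exact: agree.
exists t => V h s PVs.
have := tE (existT _ V (exist _ s (conj h PVs))).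
by rewrite /sI /=; move: (hV _) => /= h' <-; rewrite (Prop_irrelevance h' h).
Qed.

(** Taking sections is left exact: local preimages under the injective map a are
    unique, so they glue. *)
Lemma exact_lift (F G H : absheaf X) (a : sheafhom F G) (b : sheafhom G H)
    (U : opens X) (t : G U) :
  mono_sheafhom a -> exact_sheafhom a b -> b U t = 0 ->
  exists s : F U, a U s = t.
Proof.
move=> mono_a [_ ker_b] bt0.
pose P (V : opens X) (s : F V) := exists h : V `<=` U, a V s = res h t.
have [V V' W h h' s s' [hV aV] [hV' aV']|x Ux|s sE] :=
    @glue_locally F U P.
- apply: (mono_a W); rewrite !shom_res aV aV'.
  by rewrite !(res_comp _ _ (subset_trans h hV)).
- have [V [h [s [Vx aVs]]]] := ker_b U t bt0 x Ux.
  by exists V, s; split=> //; exists h.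
exists s; apply: eq_locally => x Ux.
have [V [h [s' [Vx aVs]]]] := ker_b U t bt0 x Ux.
by exists V, h; rewrite -shom_res (sE V h s') //; exists h.
Qed.

End Gluing.

(** * A criterion for injectivity on H^1 *)

Section H1.
Variables (X Y : topologicalType) (f : X -> Y) (cf : continuous f).
Variables (FY : absheaf Y) (FX : absheaf X).
Variable theta : sheafhom FY (pushforward cf FX).

(** A global section of the cokernel of theta, without constructing the quotient
    sheaf: P holds of the local sections of f_* FX that represent it. *)
Definition coker_section
    (P : forall V : opens Y, pushforward cf FX V -> Prop) : Prop :=
  (forall (V V' W : opens Y) (h : W `<=` V) (h' : W `<=` V')
     (s : pushforward cf FX V) (s' : pushforward cf FX V'),
     P V s -> P V' s' ->
     exists r : FY W, theta W r = res h s - res h' s') /\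
  (forall y : Y, exists (V : opens Y) (s : pushforward cf FX V),
     oset V y /\ P V s).

Definition coker_section_lifts
    (P : forall V : opens Y, pushforward cf FX V -> Prop) : Prop :=
  exists e : pushforward cf FX (fullopen Y),
    forall (V : opens Y) (s : pushforward cf FX V), P V s ->
      exists r : FY V, theta V r = s - res (@sub_fullopen Y V) e.

Variables (IY : injres FY) (IX : injres FX) (phi : lifting theta IY IX).

(** The connecting map from sections of the cokernel to H^1(Y, FY) is computed
    by hand: t determines a section of the cokernel, and the class of z is, up to
    sign, its image, which is zero once that section lifts to some e. *)
Lemma coboundary_descent :
  mono_sheafhom theta ->
  (forall P, coker_section P -> coker_section_lifts P) ->
  forall (z : IY 1%N (fullopen Y)) (t : IX 0%N (fullopen X)),
    diff IY 1%N _ z = 0 -> diff IX 0%N _ t = glift phi z ->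
    exists s : IY 0%N (fullopen Y), diff IY 0%N _ s = z.
Proof.
move=> mono_th lifts z t dz dt.
pose pt (V : opens Y) : pushforward cf (IX 0%N) V :=
  res (@sub_fullopen X (preim cf V)) t.
pose zr (V : opens Y) : IY 1%N V := res (@sub_fullopen Y V) z.
have ptr (V W : opens Y) (h : W `<=` V) : res h (pt V) = pt W.
  exact: (@res_comp X (IX 0%N)).
have zrr (V W : opens Y) (h : W `<=` V) : res h (zr V) = zr W.
  exact: res_comp.
have dpt V : diff IX 0%N (preim cf V) (pt V) = phi 1%N V (zr V).
  rewrite /pt shom_res dt /glift /zr shom_res.
  exact: (@res_comp X (IX 1%N)).
(* Typing the augmentation of IX as a map out of f_* FX lets it commute with
   restrictions along opens of Y. *)
pose augp (V : opens Y) (u : pushforward cf FX V) :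
  pushforward cf (IX 0%N) V := aug IX (preim cf V) u.
have augr (V W : opens Y) (h : W `<=` V) u :
    augp W (res h u) = res h (augp V u).
  exact: (shom_res (aug IX) (preim_sub cf h) u).
have lift_closed (W : opens Y) (s s' : IY 0%N W) :
    diff IY 0%N W s = diff IY 0%N W s' -> exists r, aug IY W r = s - s'.
  move=> eqd.
  apply: (exact_lift (b := diff IY 0%N) (@aug_mono _ _ IY) (@aug_exact _ _ IY)).
  by rewrite raddfB eqd subrr.
(* Both phi s and t have coboundary phi z over V, so they differ by a section u
   of f_* FX; changing s changes u by theta of a section of FY. *)
pose P (V : opens Y) (u : pushforward cf FX V) := exists s : IY 0%N V,
  diff IY 0%N V s = zr V /\ augp V u = phi 0%N V s - pt V.
have loc y : exists (V : opens Y) (u : pushforward cf FX V), oset V y /\ P V u.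
  have [_ ker] := @diff_exact _ _ IY 0%N.
  have [V [h [s [Vy ds]]]] := ker (fullopen Y) z dz y I.
  have dsz : diff IY 0%N V s = zr V.
    by rewrite ds /zr; congr (res _ z); exact: Prop_irrelevance.
  have [|u uE] := @exact_lift X _ _ _ (aug IX) (diff IX 0%N) (preim cf V)
      (phi 0%N V s - pt V) (@aug_mono _ _ IX) (@aug_exact _ _ IX).
    by rewrite raddfB dpt -lift_diff dsz subrr.
  by exists V, u; split=> //; exists s.
have agree (V V' W : opens Y) (h : W `<=` V) (h' : W `<=` V')
    (u : pushforward cf FX V) (u' : pushforward cf FX V') :
    P V u -> P V' u' -> exists r : FY W, theta W r = res h u - res h' u'.
  move=> [s [ds aus]] [s' [ds' aus']].
  have [|r rE] := lift_closed W (res h s) (res h' s').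
    by rewrite !shom_res ds ds' !zrr.
  exists r; apply: (@aug_mono _ _ IX); rewrite -(lift_aug phi) rE !raddfB.
  rewrite -!/(augp _ _) !augr aus aus' (raddfB (res h)) (raddfB (res h')) !ptr.
  rewrite !shom_res.
  by rewrite opprB addrA subrK.
have [e eE] := lifts P (conj agree loc).
(* Sections s with d s = z and phi s = t + aug e are unique, because aug and
   theta are injective; so they glue as soon as they exist locally. *)
pose te (V : opens Y) : pushforward cf (IX 0%N) V :=
  pt V + res (@sub_fullopen Y V) (augp (fullopen Y) e).
have ter (V W : opens Y) (h : W `<=` V) : res h (te V) = te W.
  by rewrite /te raddfD ptr; congr (_ + _); exact: res_comp.
pose Q (V : opens Y) (s : IY 0%N V) :=
  diff IY 0%N V s = zr V /\ phi 0%N V s = te V.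
have locQ y : exists (V : opens Y) (s : IY 0%N V), oset V y /\ Q V s.
  have [V [u [Vy Pu]]] := loc y; have [r rE] := eE V u Pu.
  have [s [ds aus]] := Pu.
  exists V, (s - aug IY V r); split=> //; split.
    by rewrite raddfB ds; have [-> _] := @aug_exact _ _ IY; rewrite subr0.
  rewrite raddfB lift_aug rE raddfB -!/(augp _ _) aus augr /te.
  by rewrite !opprB addrCA [phi _ _ _ + _]addrC subrK addrC.
have [V V' W h h' s s' [ds ps] [ds' ps']|y _|s sE] :=
    @glue_locally Y (IY 0%N) (fullopen Y) Q.
- have [|r rE] := lift_closed W (res h s) (res h' s').
    by rewrite !shom_res ds ds' !zrr.
  apply/eqP; rewrite -subr_eq0 -rE; apply/eqP.
  suff -> : r = 0 by rewrite raddf0.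
  apply: (mono_th W); apply: (@aug_mono _ _ IX).
  rewrite -(lift_aug phi) rE raddf0 raddf0 raddfB !shom_res ps ps' !ter.
  exact: subrr.
- have [V [s [Vy Qs]]] := locQ y.
  by exists V, s; split=> // ? _.
exists s; apply: eq_locally => y _.
have [V [r [Vy Qr]]] := locQ y.
exists V, (@sub_fullopen Y V); split=> //.
by rewrite -shom_res (sE V _ r Qr); case: Qr.
Qed.

Lemma Hmap1_inj :
  mono_sheafhom theta ->
  (forall P, coker_section P -> coker_section_lifts P) ->
  injective (Hmap phi 1).
Proof.
move=> mono_th lifts.
elim/quotW=> z1; elim/quotW=> z2.
rewrite !Hmap_pi => /eqP.
rewrite -[_ == _]Quotient.idealrBE /Quotient.equiv unfold_in.
move=> /asboolP /= [t].
rewrite -gliftB => dt.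
apply/eqP; rewrite -[_ == _]Quotient.idealrBE /Quotient.equiv unfold_in.
apply/asboolP => /=.
apply: coboundary_descent dt => //.
by have /eqP := Zn_valP (z1 - z2).
Qed.

End H1.

(** * Germs and constants *)

Section Germs.
Variables (X : topologicalType) (O : ringsheaf X).

Lemma rres_comp (U V W : opens X) (hVU : V `<=` U)
    (hWV : W `<=` V) (hWU : W `<=` U) (s : O U) :
  rres hWV (rres hVU s) = rres hWU s.
Proof. by have [_ ->] := rres_presheaf O. Qed.

Lemma rres_id (U : opens X) (h : U `<=` U) (s : O U) : rres h s = s.
Proof. by have [-> _] := rres_presheaf O. Qed.

Lemma germ_unitN (U : opens X) (s : O U) (x : X) :
  germ_unit (- s) x -> germ_unit s x.
Proof.
by move=> [V [h [t [Vx st]]]]; exists V, h, (- t); rewrite mulrN -mulNr -rmorphN.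
Qed.

Lemma germ_unitB (U : opens X) (s t : O U) (x : X) :
  local_stalks O -> oset U x -> germ_unit (s - t) x ->
  germ_unit s x \/ germ_unit t x.
Proof.
move=> loc Ux; have [_ add] := loc x U Ux.
by move=> /add [|/germ_unitN]; [left|right].
Qed.

End Germs.

Section Constants.
Variables (k : fieldType) (X : kscheme k).

Lemma kconst_unit (U : opens X) (c : k) (x : X) :
  oset U x -> c != 0 -> germ_unit (kconst U c) x.
Proof.
move=> Ux c0; exists U, (@subset_refl _ _), (kconst U c^-1); split=> //.
by rewrite rres_id /kconst -!rmorphM divff // !rmorph1.
Qed.

Lemma sharp_kconst (f : schememor X X) (U : opens X) (c : k) :
  over_k f -> sharp f U (kconst U c) = kconst (preim (mcont f) U) c.
Proof.
by move=> fk; rewrite /kconst sharp_res fk /kconst; apply: rres_comp.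
Qed.

End Constants.

(** * The group action on functions pulled back from the quotient *)

Section Action.
Variables (k : fieldType) (G : finGroupType) (X : kscheme k).
Variables (rho : kaction G X) (Y : scheme) (nu : schememor X Y).
Hypothesis hnu : is_quotient rho nu.

Lemma preim_stable (g : G) (V : opens Y) :
  preim (mcont nu) V `<=` preim (mcont (rho g)) (preim (mcont nu) V).
Proof.
move=> x; rewrite /preim /= /preimage /=.
suff -> : nu (rho g x) = nu x by [].
by apply/esym/(quot_orbit hnu); exists g.
Qed.

(** For V open in Y the preimage of V is G-stable, so pullback along g restricts
    to an endomorphism of its ring of functions. *)
Definition translate (g : G) (V : opens Y) :
    {rmorphism strsheaf X (preim (mcont nu) V) ->
               strsheaf X (preim (mcont nu) V)} :=
  rres (@preim_stable g V) \o sharp (rho g) (preim (mcont nu) V).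

Lemma translate_res (g : G) (V W : opens Y) (h : W `<=` V)
    (s : strsheaf X (preim (mcont nu) V)) :
  translate g W (rres (preim_sub (mcont nu) h) s) =
  rres (preim_sub (mcont nu) h) (translate g V s).
Proof.
rewrite /translate /= sharp_res.
have hWV : preim (mcont nu) W `<=` preim (mcont (rho g)) (preim (mcont nu) V).
  by move=> x Wx; apply: preim_stable; apply: h.
by rewrite !(rres_comp _ _ hWV).
Qed.

Lemma translate_kconst (g : G) (V : opens Y) (c : k) :
  translate g V (kconst _ c) = kconst _ c.
Proof.
by rewrite /translate /= (sharp_kconst _ _ (act_over rho g)); apply: rres_comp.
Qed.

Lemma translate_germ_unit (g : G) (V : opens Y) s (x : X) :
  rho g x = x -> oset (preim (mcont nu) V) x ->
  germ_unit (translate g V s) x -> germ_unit s x.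
Proof.
move=> gx Vx /germ_unit_res u; rewrite -gx.
by apply: sharp_local u; rewrite gx.
Qed.

Lemma translate_invariantP (V : opens Y)
    (s : strsheaf X (preim (mcont nu) V)) :
  (exists t, sharp nu V t = s) <-> forall g, translate g V s = s.
Proof.
rewrite (quot_inv hnu); split=> [inv g|fixd g U hU hgU].
  by rewrite /translate /= (inv g _ (@subset_refl _ _)) rres_id.
rewrite -[in RHS](fixd g) /translate /=.
by rewrite (rres_comp _ _ hgU).
Qed.

(** With c the value of s at x, g s - s = g (s - c) - (s - c), and neither term
    is a unit at x: the pullback of a nonunit along g is a nonunit at x = g x. *)
Lemma translateB_fixed_point (g : G) (V : opens Y) s (x : X) :
  rational_point x -> rho g x = x -> oset (preim (mcont nu) V) x ->
  ~ germ_unit (translate g V s - s) x.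
Proof.
move=> hx gx Vx; have [c nu_c] := hx _ s Vx.
have -> : translate g V s - s =
    translate g V (s - kconst _ c) - (s - kconst _ c).
  by rewrite rmorphB translate_kconst opprB addrA subrK.
by move=> /(germ_unitB (@scheme_local X) Vx) [/(translate_germ_unit gx Vx)|].
Qed.

(** The representatives of a global section of the cokernel of O_Y -> nu_* O_X
    are invariant: the defects g s - s glue to a constant vanishing at x. *)
Lemma coker_section_quotient
    (P : forall V : opens Y, pushforward (mcont nu) (O_ X) V -> Prop) (x : X) :
  (forall c, exists a, kstr X a = c) ->
  rational_point x -> (forall g : G, rho g x = x) ->
  coker_section (sharp_hom nu) P ->
  forall V s, P V s -> exists r, sharp_hom nu V r = s.
Proof.
move=> surj hx hfix [agree loc] V s PVs.
apply/translate_invariantP => g.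
(* The defects live over preimages of opens of Y; restricting them to all smaller
   opens of X makes them a condition on sections over any open. *)
pose D (U : opens X) (c : strsheaf X U) :=
  exists (V : opens Y) (h : U `<=` preim (mcont nu) V)
    (s : strsheaf X (preim (mcont nu) V)),
  P V s /\ c = rres h (translate g V s - s).
have [U U' W h h' c c' [V1 [h1 [s1 [P1 ->]]]] [V2 [h2 [s2 [P2 ->]]]]|y _|c cE]
    := @glue_locally X (O_ X) (fullopen X) D.
- have hW1 := subset_trans h h1; have hW2 := subset_trans h' h2.
  change (rres h (rres h1 (translate g V1 s1 - s1)) =
          rres h' (rres h2 (translate g V2 s2 - s2))).
  rewrite (rres_comp _ _ hW1) (rres_comp _ _ hW2).
  (* The two defects are compared over the preimage of V1 meet V2, where s1 - s2
     comes from Y. *)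
  pose V12 := Opens (openI (openP V1) (openP V2)).
  have i1 : V12 `<=` V1 by move=> ? [].
  have i2 : V12 `<=` V2 by move=> ? [].
  have hW : W `<=` preim (mcont nu) V12.
    by move=> w Ww; split; [exact: hW1|exact: hW2].
  rewrite -(rres_comp (preim_sub (mcont nu) i1) hW).
  rewrite -(rres_comp (preim_sub (mcont nu) i2) hW); congr (rres hW _).
  have [r rE] := agree _ _ _ i1 i2 _ _ P1 P2.
  have /translate_invariantP/(_ g) : exists t, sharp nu V12 t =
      rres (preim_sub (mcont nu) i1) s1 - rres (preim_sub (mcont nu) i2) s2.
    by exists r.
  rewrite [in LHS]rmorphB !translate_res => /eqP.
  rewrite -subr_eq0 opprD addrACA -opprD subr_eq0 => /eqP.
  by rewrite -!(rmorphB (rres _)).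
- have [V1 [s1 [Vy P1]]] := loc (nu y).
  exists (preim (mcont nu) V1), (translate g V1 s1 - s1); split=> //.
  by exists V1, (@subset_refl _ _), s1; rewrite rres_id.
have [a ac] := surj c.
have defect V1 s1 : P V1 s1 -> translate g V1 s1 - s1 = kconst _ a.
  move=> P1; rewrite /kconst ac; apply/esym/cE.
  by exists V1, (@subset_refl _ _), s1; rewrite rres_id.
have a0 : a = 0.
  have [V1 [s1 [Vx P1]]] := loc (nu x).
  apply/eqP/negPn/negP => /(@kconst_unit _ _ (preim (mcont nu) V1) _ x Vx).
  by rewrite -(defect _ _ P1); apply: translateB_fixed_point.
by apply/eqP; rewrite -subr_eq0 defect // a0 /kconst !rmorph0.
Qed.

End Action.

Theorem lemma4p2 (k : fieldType) (G : finGroupType) (X : kscheme k)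
    (rho : kaction G X) (Y : scheme) (nu : schememor X Y)
    (hnu : is_quotient rho nu)
    (hk : bijective (kstr X))
    (x : X) (hx : rational_point x) (hfix : forall g : G, rho g x = x)
    (IY : injres (O_ Y)) (IX : injres (O_ X))
    (phi : lifting (sharp_hom nu) IY IX) :
  injective (Hmap phi 1).
Proof.
(* All representatives come from O_Y, so 0 lifts the section of the cokernel. *)
apply: Hmap1_inj => [V|P cokerP]; first exact: quot_inj hnu V.
exists 0 => V s PVs; rewrite raddf0 subr0.
apply: (coker_section_quotient hnu _ hx hfix cokerP PVs) => c.
by have [inv _ invK] := hk; exists (inv c).
Qed.
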